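(* The operad $\mathcal{A}\mathrm{LR}$ governed by the variety of $\mathcal{A}\mathrm{LR}$-algebras satisfies the Dong property (in the sense of Kolesnikov–Sartayev).
   Context: The base field is $\mathbb{C}$. An $\mathcal{A}\mathrm{LR}$-algebra (antibicommutative algebra) is an algebra $(A,\cdot)$ with a bilinear multiplication satisfying $x\cdot(y\cdot z)+y\cdot(x\cdot z)=0$ and $(x\cdot y)\cdot z+(x\cdot z)\cdot y=0$ for all $x,y,z$. Dong property: for an algebra $A$, a formal distribution over $A$ is a series $a(z)\in A[[z,z^{-1}]]$. An ordered pair $(a(z),b(z))$ of formal distributions is local if there is $N\ge 0$ with $(w-z)^N a(w)b(z)=0$ in $A[[w,w^{-1},z,z^{-1}]]$; $a$ and $b$ are mutually local if both $(a,b)$ and $(b,a)$ are local. For $n\ge0$ the $n$-product is $(a_{(n)}b)(z)=\mathrm{Res}_{w}\,(w-z)^n a(w)b(z)$, where $\mathrm{Res}_w$ is the coefficient of $w^{-1}$. A variety (or the operad governing it) satisfies the Dong property if, for every algebra $A$ in the variety, whenever $a(z),b(z),c(z)$ are pairwise mutually local formal distributions over $A$, the distributions $(a_{(n)}b)(z)$ and $c(z)$ are mutually local for every $n\ge0$. *)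

(* Defs.v *)
From HB Require Import structures.
From mathcomp Require Import all_boot all_order all_algebra.
From mathcomp Require Import sesquilinear.
From mathcomp Require Import complex.
From mathcomp Require Import reals.

Set Implicit Arguments.
Unset Strict Implicit.
Unset Printing Implicit Defensive.

Import GRing.Theory.
Local Open Scope ring_scope.

(* A nonassociative algebra over [K]: no identity is imposed on the product. *)
Record algebra (K : fieldType) := Algebra {
  algebra_sort :> lmodType K;
  algebra_mul : {bilinear algebra_sort -> algebra_sort -> algebra_sort}
}.

Notation "x ⋅ y" := (algebra_mul _ x y)
  (at level 40, left associativity) : ring_scope.

Definition ALR (K : fieldType) (A : algebra K) : Prop :=
  (forall x y z : A, x ⋅ (y ⋅ z) + y ⋅ (x ⋅ z) = 0) /\
  (forall x y z : A, (x ⋅ y) ⋅ z + (x ⋅ z) ⋅ y = 0).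

Section FormalDistributions.
Variables (K : fieldType) (A : algebra K).

(* [a n] is the coefficient of z^n, and [F m n] that of w^m z^n; the residue
   is therefore taken at index -1. *)
Definition distr : Type := int -> A.
Definition distr2 : Type := int -> int -> A.

(* a(w) b(z) *)
Definition distr_prod (a b : distr) : distr2 := fun m n => a m ⋅ b n.

(* (w - z) F(w, z) *)
Definition mul_wz (F : distr2) : distr2 :=
  fun m n => F (m - 1) n - F m (n - 1).

Definition mul_wz_exp (N : nat) (F : distr2) : distr2 := iter N mul_wz F.

Definition Res_w (F : distr2) : distr := fun n => F (- 1) n.

Definition local (a b : distr) : Prop :=
  exists N : nat, forall m n : int, mul_wz_exp N (distr_prod a b) m n = 0.

Definition mutually_local (a b : distr) : Prop := local a b /\ local b a.

Definition n_product (n : nat) (a b : distr) : distr :=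
  Res_w (mul_wz_exp n (distr_prod a b)).

End FormalDistributions.

(* A variety enters only through its class of algebras [V]. *)
Definition Dong_property (K : fieldType) (V : algebra K -> Prop) : Prop :=
  forall A : algebra K, V A ->
  forall a b c : distr A,
    mutually_local a b -> mutually_local a c -> mutually_local b c ->
  forall n : nat, mutually_local (n_product n a b) c.

(* Main.v *)
(* Write the triple products in three variables x, y, z. The right identity
   gives (a(x)b(y))c(z) = - (a(x)c(z))b(y), so this series is killed by powers
   of both x - y and x - z, hence by a power of y - z = (x - z) - (x - y). The
   left identity gives c(y)(a(x)b(z)) = - a(x)(c(y)b(z)), so a power of y - z
   kills it at once. Multiplication by powers of linear forms commutes, so both
   facts survive multiplication by the n-th power defining the n-product and
   the residue in x. *)
Require Import Defs.
From mathcomp Require Import all_boot all_order all_algebra.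
From mathcomp Require Import sesquilinear.
From mathcomp Require Import boolp functions.
From mathcomp Require Import complex.
From mathcomp Require Import reals.

Set Implicit Arguments.
Unset Strict Implicit.
Unset Printing Implicit Defensive.

Import GRing.Theory.
Local Open Scope ring_scope.

Lemma iter_comm (T : Type) (f g : T -> T) (i j : nat) (x : T) :
    (forall y, f (g y) = g (f y)) ->
  iter i f (iter j g x) = iter j g (iter i f x).
Proof.
by move=> fg; elim: i => //= i ->; elim: j => //= j IHj; rewrite fg IHj.
Qed.

(** Additivity and commutation of the multiplications by linear forms below all come down,
    coefficient by coefficient, to this exchange. *)
Lemma subrBACA (V : zmodType) (x y z t : V) :
  x - y - (z - t) = x - z - (y - t).
Proof. by rewrite !opprD !opprK addrACA. Qed.

Section IterSub.
Variables (V : zmodType) (f : V -> V).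
Hypothesis fB : {morph f : x y / x - y}.

Lemma iter_sub i : {morph iter i f : x y / x - y}.
Proof. by elim: i => // i IHi x y /=; rewrite IHi fB. Qed.

Lemma iter_sub0 i : iter i f 0 = 0.
Proof. by rewrite -[X in iter _ _ X](subrr 0) iter_sub subrr. Qed.

End IterSub.

(** A double induction replaces the binomial expansion of (f - g)^(i + j): one application of f - g
    leaves [f x], which needs one [f] fewer to vanish, and [g x], which needs one [g] fewer;
    commutation keeps the other vanishing condition. *)
Lemma iter_diff_eq0 (V : zmodType) (f g : V -> V) (i j : nat) (x : V) :
    {morph f : x y / x - y} -> {morph g : x y / x - y} ->
    (forall y, f (g y) = g (f y)) ->
  iter i f x = 0 -> iter j g x = 0 -> iter (i + j) (fun y => f y - g y) x = 0.
Proof.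
move=> fB gB fg; set h := fun y => _.
have hB : {morph h : x y / x - y} by move=> y z; rewrite /h fB gB subrBACA.
elim: i j x => [|i IHi] j x.
  by move=> x0 _; rewrite (x0 : x = 0) (iter_sub0 hB).
elim: j x => [|j IHj] x.
  by move=> _ x0; rewrite (x0 : x = 0) (iter_sub0 hB).
move=> fx gx; rewrite addSn iterSr (iter_sub hB) IHi.
- rewrite -addSnnS IHj ?subrr //.
  + by rewrite -[g x]/(iter 1 g x) iter_comm // fx (iter_sub0 gB).
  + by rewrite -iterSr.
- by rewrite -iterSr.
- by rewrite -[f x]/(iter 1 f x) -iter_comm // gx (iter_sub0 fB).
Qed.

Section ThreeVariables.
Variables (K : fieldType) (A : algebra K).

(** [F m n l] is the coefficient of x^m y^n z^l. *)
Definition distr3 : Type := int -> int -> int -> A.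

Definition mul_xy (F : distr3) : distr3 :=
  fun m n l => mul_wz (fun m n => F m n l) m n.
Definition mul_xz (F : distr3) : distr3 :=
  fun m n l => mul_wz (fun m l => F m n l) m l.
Definition mul_yz (F : distr3) : distr3 := fun m => mul_wz (F m).

Lemma iter_mul_xy N (F : distr3) m n l :
  iter N mul_xy F m n l = mul_wz_exp N (fun m n => F m n l) m n.
Proof. by elim: N m n => //= N IHN m n; rewrite /mul_xy /mul_wz !IHN. Qed.

Lemma iter_mul_xz N (F : distr3) m n l :
  iter N mul_xz F m n l = mul_wz_exp N (fun m l => F m n l) m l.
Proof. by elim: N m l => //= N IHN m l; rewrite /mul_xz /mul_wz !IHN. Qed.

Lemma iter_mul_yz N (F : distr3) m n l :
  iter N mul_yz F m n l = mul_wz_exp N (F m) n l.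
Proof. by elim: N n l => //= N IHN n l; rewrite /mul_yz /mul_wz !IHN. Qed.

(** This is [distr3] seen with its pointwise group structure. *)
Let V : zmodType := int -> int -> int -> A.

Lemma mul_xyB : {morph (mul_xy : V -> V) : F G / F - G}.
Proof. by move=> F G; do 3!apply/funext=> ?; exact: subrBACA. Qed.

Lemma mul_xzB : {morph (mul_xz : V -> V) : F G / F - G}.
Proof. by move=> F G; do 3!apply/funext=> ?; exact: subrBACA. Qed.

Lemma mul_xzyC F : mul_xz (mul_xy F) = mul_xy (mul_xz F).
Proof. by do 3!apply/funext=> ?; exact: subrBACA. Qed.

Lemma mul_yzxC F : mul_yz (mul_xz F) = mul_xz (mul_yz F).
Proof. by do 3!apply/funext=> ?; exact: subrBACA. Qed.

Lemma mul_yzE : mul_yz = (fun F : V => (mul_xz F : V) - mul_xy F).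
Proof.
apply/funext=> F; do 3!apply/funext=> ?.
by apply/esym/(etrans (subrBACA _ _ _ _)); rewrite subrr sub0r opprB.
Qed.

(** With [h] a product by a fixed coefficient, up to sign, this carries locality of two series over
    to triple products. *)
Lemma mul_wz_exp_morph (h : A -> A) N (F : distr2 A) m n :
    {morph h : x y / x - y} ->
  mul_wz_exp N (fun m n => h (F m n)) m n = h (mul_wz_exp N F m n).
Proof.
by move=> hB; elim: N m n => //= N IHN m n; rewrite /mul_wz !IHN hB.
Qed.

Variables (a b c : distr A).
Hypothesis ALR_A : ALR A.

(** The variable x comes first, so that the residue in x is plain application to [- 1]; what remains
    has its left outer factor in y and its right one in z. *)
Let prod_l : V := fun m n l => (a m ⋅ b n) ⋅ c l.
Let prod_r : V := fun m n l => c n ⋅ (a m ⋅ b l).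

Lemma local_n_productl k : local a b -> local a c -> local (n_product k a b) c.
Proof.
move=> [i ab0] [j ac0].
have xy0 : iter i mul_xy prod_l = 0.
  apply/funext=> m; apply/funext=> n; apply/funext=> l; rewrite iter_mul_xy.
  rewrite (mul_wz_exp_morph (h := fun x => x ⋅ c l) i (distr_prod a b)).
    by rewrite ab0 linear0l.
  by move=> x y; rewrite linearBl.
have xz0 : iter j mul_xz prod_l = 0.
  apply/funext=> m; apply/funext=> n; apply/funext=> l; rewrite iter_mul_xz.
  have -> : (fun m l => prod_l m n l)
      = (fun m l => - (distr_prod a c m l ⋅ b n)).
    apply/funext=> m'; apply/funext=> l'; apply/eqP; rewrite -addr_eq0.
    by rewrite ALR_A.2.
  rewrite (mul_wz_exp_morph (h := fun x => - (x ⋅ b n))).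
    by rewrite ac0 linear0l oppr0.
  by move=> x y; rewrite linearBl opprD.
(* [j] counts factors x - z and [i] factors x - y; the sum serves for every [k]. *)
exists (j + i)%N => n l.
have -> : distr_prod (n_product k a b) c = iter k mul_xy prod_l (- 1).
  apply/funext=> n'; apply/funext=> l'; rewrite iter_mul_xy.
  rewrite (mul_wz_exp_morph (h := fun x => x ⋅ c l') k (distr_prod a b)) //.
  by move=> x y; rewrite linearBl.
rewrite -iter_mul_yz mul_yzE iter_diff_eq0 //.
- exact: mul_xzB.
- exact: mul_xyB.
- exact: mul_xzyC.
- rewrite iter_comm; last exact: mul_xzyC.
  by rewrite xz0 (iter_sub0 mul_xyB).
- by rewrite iter_comm // xy0 (iter_sub0 mul_xyB).
Qed.

Lemma local_n_productr k : local c b -> local c (n_product k a b).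
Proof.
move=> [i cb0]; exists i => n l.
have yz0 : iter i mul_yz prod_r = 0.
  apply/funext=> m'; apply/funext=> n'; apply/funext=> l'; rewrite iter_mul_yz.
  have -> : prod_r m' = (fun n l => - (a m' ⋅ distr_prod c b n l)).
    apply/funext=> ?; apply/funext=> ?; apply/eqP; rewrite -addr_eq0.
    by rewrite ALR_A.1.
  rewrite (mul_wz_exp_morph (h := fun x => - (a m' ⋅ x))).
    by rewrite cb0 linear0r oppr0.
  by move=> x y; rewrite linearBr opprD.
(* Here [b] lives in z, so the factor defining the product of [a] and [b] is (x - z)^k. *)
have -> : distr_prod c (n_product k a b) = iter k mul_xz prod_r (- 1).
  apply/funext=> n'; apply/funext=> l'; rewrite iter_mul_xz.
  rewrite (mul_wz_exp_morph (h := fun x => c n' ⋅ x) k (distr_prod a b)) //.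
  by move=> x y; rewrite linearBr.
rewrite -iter_mul_yz iter_comm; last exact: mul_yzxC.
by rewrite yz0 (iter_sub0 mul_xzB).
Qed.

End ThreeVariables.

Theorem corollary52 (R : realType) : Dong_property (@ALR R[i]).
Proof.
move=> A ALR_A a b c [ab _] [ac _] [_ cb] n; split.
  exact: local_n_productl.
exact: local_n_productr.
Qed.
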